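(* Let $\mathbf{s}: d_1\le d_2\le\cdots\le d_n$ be a tree degree sequence of length $n$, let $\mathcal{T}_{\mathbf{s}}$ be the set of all trees with degree sequence $\mathbf{s}$, and let $a(\mathbf{s})$ be the annihilation number of $\mathbf{s}$. Define $\nu_m(\mathcal{T}_{\mathbf{s}})=\min_{T\in\mathcal{T}_{\mathbf{s}}}\nu(T)$, $\eta_M(\mathcal{T}_{\mathbf{s}})=\max_{T\in\mathcal{T}_{\mathbf{s}}}\eta(T)$ and $\alpha_M(\mathcal{T}_{\mathbf{s}})=\max_{T\in\mathcal{T}_{\mathbf{s}}}\alpha(T)$. Then \[ \nu_m(\mathcal{T}_{\mathbf{s}})=n-a(\mathbf{s}),\qquad \eta_M(\mathcal{T}_{\mathbf{s}})=2a(\mathbf{s})-n,\qquad \alpha_M(\mathcal{T}_{\mathbf{s}})=a(\mathbf{s}). \]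
   Context: A tree degree sequence of length $n$ is a degree sequence (of some graph) $d_1\le d_2\le\dots\le d_n$ with $\sum_{i=1}^n d_i=2n-2$. The annihilation number $a(\mathbf{s})$ of a degree sequence $d_1\le\dots\le d_n$ of a graph with $m$ edges (here $m=n-1$) is the largest index $a$ such that $\sum_{i=1}^{a} d_i\le m$. For a graph $G$: $\nu(G)$ is the matching number, $\alpha(G)$ is the independence number, and the nullity $\eta(G)$ is the multiplicity of the eigenvalue $0$ of the adjacency matrix of $G$.
   Formalization: For n > 1 all entries of the tree degree sequence are required to be positive; otherwise sequences such as 0,2,2,2 (a triangle plus an isolated vertex) have sum 2n−2 but no tree realizes them, so the minimum and maxima are undefined. *)

(* Defs.v *)
From HB Require Import structures.
From mathcomp Require Import all_boot all_order all_algebra all_field.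

Set Implicit Arguments.
Unset Strict Implicit.
Unset Printing Implicit Defensive.

Import Order.TTheory GRing.Theory Num.Theory.

Record sgraph := SGraph {
  vertex :> finType;
  edge : rel vertex;
  edge_sym : symmetric edge;
  edge_irr : irreflexive edge
}.

Definition degree (G : sgraph) (x : G) : nat := #|[set y | edge x y]|.

Definition degree_seq (G : sgraph) : seq nat :=
  sort leq [seq degree x | x <- enum G].

Definition connected (G : sgraph) : Prop :=
  0 < #|G| /\ forall x y : G, connect (@edge G) x y.

(* By symmetry of [edge], any edge is a [ucycle] of length 2; only the
   [ucycle]s with at least three vertices are cycles of the graph. *)
Definition acyclic (G : sgraph) : Prop :=
  forall c : seq G, 2 < size c -> ~ ucycle (@edge G) c.

Definition is_tree (G : sgraph) : Prop := connected G /\ acyclic G.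

Definition edges (G : sgraph) : {set {set G}} :=
  [set [set p.1; p.2] | p : G * G & edge p.1 p.2].

Definition is_matching (G : sgraph) (M : {set {set G}}) : bool :=
  (M \subset edges G) && trivIset M.

Definition matching_number (G : sgraph) : nat :=
  \max_(M : {set {set G}} | is_matching M) #|M|.

Definition is_independent (G : sgraph) (A : {set G}) : bool :=
  [forall x in A, forall y in A, ~~ edge x y].

Definition independence_number (G : sgraph) : nat :=
  \max_(A : {set G} | is_independent A) #|A|.

Definition adjmx (G : sgraph) : 'M[algC]_#|G| :=
  (\matrix_(i, j) (edge (enum_val i) (enum_val j))%:R)%R.

Definition nullity (G : sgraph) : nat := mup 0%R (char_poly (adjmx G)).

(* The sum condition is sum = 2n - 2 without truncated subtraction; it forces
   n > 0. The last clause excludes sequences such as 0,2,2,2, which is graphic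
   with sum 2n - 2 but is not the degree sequence of any tree; the sequence 0
   of the one-vertex tree is allowed. *)
Definition tree_degree_seq (n : nat) (s : seq nat) : Prop :=
  [/\ size s = n, sorted leq s, exists G : sgraph, degree_seq G = s,
      sumn s + 2 = 2 * n & 1 < n -> 0 \notin s].

(* A graph with degree sequence [s] has (sumn s)./2 edges. *)
Definition annihilation_number (s : seq nat) : nat :=
  \max_(a < (size s).+1 | sumn (take a s) <= (sumn s)./2) a.

Definition trees_with (s : seq nat) (G : sgraph) : Prop :=
  is_tree G /\ degree_seq G = s.

(* Values in int, so that differences of natural numbers are not truncated. *)
Definition is_min (P : sgraph -> Prop) (f : sgraph -> nat) (k : int) : Prop :=
  (exists2 G, P G & Posz (f G) = k) /\ forall G, P G -> (k <= Posz (f G))%R.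

Definition is_max (P : sgraph -> Prop) (f : sgraph -> nat) (k : int) : Prop :=
  (exists2 G, P G & Posz (f G) = k) /\ forall G, P G -> (Posz (f G) <= k)%R.

(* Main.v *)
(* An independent set [A] has degree sum at most the number of edges, so
   [#|A| <= a(s)]. In a forest, pruning leaves yields an independent set [A] and
   a matching of size [n - #|A|]. By the Leibniz formula the characteristic
   polynomial of a forest is a sum over its matchings without cancellation, so
   the nullity is the least number of uncovered vertices. Thus each bound follows
   from the one on independent sets, and all three are attained by a single tree
   in which [a(s)] vertices of smallest degree are independent. It is built leaf by
   leaf: a set with degree sum at most [n - 1] can always be made independent. *)

Require Import Defs.
From HB Require Import structures.
From mathcomp Require Import all_boot all_order all_algebra all_field.
From mathcomp Require Import all_fingroup.
From mathcomp Require Import zify.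

Import Order.TTheory GRing.Theory Num.Theory.
Local Open Scope ring_scope.

(** * Matchings and independent sets in forests *)

(** If every vertex of [S] had two neighbours in [S], any path in [S] could be prolonged at its
    head, and would outgrow [#|G|]. *)
Lemma acyclic_leaf {G : sgraph} (S : {set G}) : acyclic G -> S != set0 ->
  exists2 x, x \in S & (#|[set y in S | edge x y]| <= 1)%N.
Proof.
move=> acG /set0Pn[x0 Sx0]; apply/exists_inP; apply: contraT => /exists_inPn noleaf.
have long k : exists x p,
    [/\ size p = k, path (@edge G) x p, uniq (x :: p) & all [in S] (x :: p)].
  elim: k => [|k [x [p [szp xp Up Sp]]]]; first by exists x0, [::]; rewrite /= Sx0.
  have Sx : x \in S by case/andP: Sp.
  have /card_gt1P[y [z []]] : (1 < #|[set y in S | edge x y]|)%N.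
    by rewrite ltnNge noleaf.
  rewrite !inE => /andP[Sy xy] /andP[Sz xz] nyz.
  have xNx w : edge x w -> w != x by apply: contraTneq => ->; rewrite edge_irr.
  (* A chord from the end of a path back into it would close a cycle. *)
  have chord w : edge x w -> w != head x p -> w \notin p.
    move=> xw whd; apply/negP => pw; case/splitPr: p / pw whd xp Up {szp Sp}.
    move=> p1 p2 whd; rewrite cat_path => /andP[xp1 /andP[p1w _]] Up.
    have {}Up : uniq (x :: rcons p1 w).
      by move: Up; rewrite -cat_rcons -cat_cons cat_uniq => /andP[].
    apply: (acG (x :: rcons p1 w)).
      by case: p1 whd {xp1 p1w Up} => [|u p1]; rewrite /= ?eqxx // size_rcons.
    by rewrite /ucycle Up /= !rcons_path last_rcons xp1 p1w edge_sym xw.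
  have [w [Sw xw pw]] : exists w, [/\ w \in S, edge x w & w \notin p].
    have [yhd|/(chord _ xy)] := eqVneq y (head x p); last by exists y.
    by exists z; split=> //; apply: chord => //; rewrite -yhd eq_sym.
  exists w, (x :: p); rewrite /= edge_sym xw szp; split=> //.
    by rewrite inE negb_or (xNx _ xw) pw.
  by rewrite Sw.
have [x [p [szp _ Up _]]] := long #|G|.
by have := max_card (mem (x :: p)); rewrite (card_uniqP Up) /= szp ltnn.
Qed.

(** An involutive [edge_map] encodes a matching, its fixed points being the uncovered vertices. The
    injective ones are the permutations that survive in the Leibniz expansion. *)
Definition edge_map {G : sgraph} (f : G -> G) : Prop :=
  forall x, (f x == x) || edge x (f x).

(** Induction on [#|S|]: a vertex [x] with at most one neighbour [v] in [S] joins [A], both are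
    deleted from [S], and [f] is changed to swap them. That [f] is the identity off the smaller set
    makes this change safe. *)
Lemma konig_on {G : sgraph} (S : {set G}) : acyclic G ->
  exists f (A : {set G}), [/\ involutive f, edge_map f, is_independent A,
    {in ~: S, f =1 id} & A \subset S /\ {in S :\: A, forall x, f x \in A}].
Proof.
move=> acG; have [m] := ubnP #|S|; elim: m S => // m IH S ltS.
have [->|S0] := eqVneq S set0.
  exists id, set0; split=> //.
  - by move=> x; rewrite eqxx.
  - by apply/forall_inP => x; rewrite inE.
  - by split=> // x; rewrite !inE.
have [x Sx] := acyclic_leaf S acG S0.
rewrite leq_eqVlt ltnS leqn0 => leafx.
pose N := [set y in S | edge x y].
have xN : x \notin N by rewrite inE edge_irr andbF.
have ltSN : (#|S :\ x :\: N| < m)%N.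
  apply: leq_trans (_ : #|S :\ x| < m)%N; first by rewrite ltnS subset_leq_card ?subsetDl.
  by move: ltS; rewrite (cardsD1 x S) Sx.
have [f [A [fK fe indA fS [AS fA]]]] := IH _ ltSN.
have fx : f x = x by apply: fS; rewrite !inE eqxx andbF.
have indxA : is_independent (x |: A).
  have xA y : y \in A -> ~~ edge x y.
    by move/(subsetP AS); rewrite !inE => /and3P[yN _ Sy]; rewrite Sy in yN.
  apply/forall_inP => y /setU1P[->|Ay]; apply/forall_inP => z /setU1P[->|Az].
  - by rewrite edge_irr.
  - exact: xA.
  - by rewrite edge_sym xA.
  - by move/forall_inP/(_ y Ay)/forall_inP: indA; apply.
have AxS : x |: A \subset S.
  rewrite subUset sub1set Sx (subset_trans AS) //.
  by rewrite (subset_trans (subsetDl _ _)) ?subsetDl.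
case/orP: leafx => [/cards1P[v Nv]|]; last first.
  rewrite cards_eq0 => /eqP N0; rewrite -/N in N0.
  exists f, (x |: A); split=> //.
    by move=> y; rewrite inE => yS; apply: fS; rewrite !inE (negPf yS) !andbF.
  split=> // y; rewrite !inE negb_or => /andP[/andP[yx yA] Sy].
  by rewrite fA ?orbT // N0 !inE yA yx Sy.
rewrite -/N in Nv.
have /andP[Sv xv] : (v \in S) && edge x v by have := set11 v; rewrite -Nv inE.
have vx : v != x by apply: contraTneq xv => ->; rewrite edge_irr.
have fv : f v = v by apply: fS; rewrite Nv !inE eqxx.
pose g y := if y == x then v else if y == v then x else f y.
exists g, (x |: A); split=> //.
- move=> y; rewrite /g; have [->|yx] := eqVneq y x; first by rewrite (negPf vx) eqxx.
  have [->|yv] := eqVneq y v; first by rewrite eqxx.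
  by rewrite -fx (inj_eq (inv_inj fK)) (negPf yx) -fv (inj_eq (inv_inj fK)) (negPf yv) fK.
- move=> y; rewrite /g; have [->|yx] := eqVneq y x; first by rewrite xv orbT.
  by have [->|yv] := eqVneq y v; rewrite ?fe // edge_sym xv orbT.
- move=> y; rewrite inE => yS; rewrite /g.
  rewrite !ifN; first by apply: fS; rewrite !inE (negPf yS) !andbF.
    by apply: contraNneq yS => ->.
  by apply: contraNneq yS => ->.
split=> // y; rewrite !inE negb_or => /andP[/andP[yx yA] Sy].
rewrite /g (negPf yx); have [|yv] := eqVneq y v; first by rewrite eqxx.
by rewrite fA ?orbT // Nv !inE yA yx yv Sy.
Qed.

(* König's theorem for forests: the edges [{x, f x}] with [x] outside [A] form
   a matching, and [~: A] is a vertex cover of the same size. *)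
Lemma konig {G : sgraph} : acyclic G ->
  exists f (A : {set G}), [/\ involutive f, edge_map f, is_independent A &
    {in ~: A, forall x, f x \in A}].
Proof.
move=> /(konig_on setT)[f [A [fK fe indA _ [_ fA]]]].
by exists f, A; split=> // x; rewrite inE => xA; apply: fA; rewrite !inE xA.
Qed.

(** An unfixed vertex of [A] is sent outside [A] by independence, so the fixed points are [A] minus
    the image of [~: A], which has size [#|~: A|]. *)
Lemma fixpoints_konig {G : sgraph} (f : G -> G) (A : {set G}) :
    involutive f -> edge_map f -> is_independent A ->
    {in ~: A, forall x, f x \in A} ->
  (#|[set x | f x == x]| + #|G| = 2 * #|A|)%N.
Proof.
move=> fK fe indA fA.
have -> : [set x | f x == x] = A :\: f @: ~: A.
  apply/setP=> x; rewrite !inE; apply/eqP/andP => [fx|[xf xA]].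
    have xA : x \in A by apply: contraT => xA; have := fA x; rewrite fx inE (negPf xA); apply.
    split=> //; apply/imsetP => -[y]; rewrite inE => yA xy.
    by rewrite -(fK y) -xy fx xA in yA.
  have fxA : f x \in A.
    by apply: contraR xf => fxA; apply/imsetP; exists (f x); rewrite ?inE ?fK.
  apply/eqP; have /orP[//|xe] := fe x.
  by move/forall_inP/(_ x xA)/forall_inP/(_ _ fxA)/negP: indA.
have sub : (f @: ~: A) \subset A by apply/subsetP => _ /imsetP[y yA ->]; apply: fA.
rewrite cardsD (setIidPr sub) card_imset; last exact: inv_inj.
have := cardsC A; have := subset_leq_card sub.
by rewrite card_imset; [lia | exact: inv_inj].
Qed.

(** Each vertex of [A] is fixed or sent into [~: A], and by injectivity at most [#|~: A|] vertices
    are sent there. *)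
Lemma fixpoints_ge {G : sgraph} (f : G -> G) (A : {set G}) :
    injective f -> edge_map f -> is_independent A ->
  (2 * #|A| <= #|[set x | f x == x]| + #|G|)%N.
Proof.
move=> fI fe indA.
have sub : A \subset [set x | f x == x] :|: f @^-1: ~: A.
  apply/subsetP => x xA; rewrite !inE.
  have /orP[->//|xe] := fe x; apply/orP; right.
  apply: contraL xe => fxA.
  by move/forall_inP/(_ x xA)/forall_inP/(_ _ fxA): indA.
have := subset_leq_card sub.
have : (#|f @^-1: ~: A| <= #|~: A|)%N.
  rewrite -(card_imset _ fI) subset_leq_card //.
  by apply/subsetP => _ /imsetP[y yA ->]; rewrite inE in yA.
rewrite cardsU; have := cardsC A; lia.
Qed.

(** Every edge of [M] has an end outside [A], and disjoint edges have distinct ends. *)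
Lemma matching_le {G : sgraph} (M : {set {set G}}) (A : {set G}) :
  is_matching M -> is_independent A -> (#|M| + #|A| <= #|G|)%N.
Proof.
move=> /andP[Me tM] indA.
suff : (#|M| <= #|~: A|)%N by have := cardsC A; lia.
rewrite -sum1_card -[#|~: A|]sum1_card.
have leM : (\sum_(B in M) 1 <= \sum_(B in M) \sum_(x in B) (x \notin A))%N.
  apply: leq_sum => B /(subsetP Me)/imsetP[[x y] /= exy ->].
  rewrite inE /= in exy.
  have nxy : x \notin [set y] by rewrite inE; apply: contraTneq exy => ->; rewrite edge_irr.
  rewrite big_setU1 // big_set1 /=.
  case xA: (x \in A) => //; case yA: (y \in A) => //.
  by move/forall_inP/(_ x xA)/forall_inP/(_ y yA)/negP: indA.
apply: leq_trans leM _; rewrite -big_trivIset //= -big_mkcondr /=.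
rewrite [X in (X <= _)%N](eq_bigl [in cover M :&: ~: A]).
  by rewrite !sum1_card subset_leq_card ?subsetIr.
by move=> x; rewrite !inE.
Qed.

Lemma matching_number_ge {G : sgraph} (f : G -> G) (A : {set G}) :
    involutive f -> edge_map f -> {in ~: A, forall x, f x \in A} ->
  (#|~: A| <= matching_number G)%N.
Proof.
move=> fK fe fA; pose m x := [set x; f x].
have mE x y : y \in m x -> m y = m x.
  by rewrite !inE => /orP[]/eqP->; rewrite /m // fK setUC.
have mI : {in ~: A &, injective m}.
  move=> x y xA yA mxy; have : y \in m x by rewrite mxy !inE eqxx.
  rewrite !inE => /orP[/eqP->//|/eqP yfx].
  by move: (fA x xA); rewrite -yfx => yA'; rewrite inE yA' in yA.
rewrite -(card_in_imset mI).
apply: (@leq_bigmax_cond _ _ (fun M : {set {set G}} => #|M|)).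
apply/andP; split.
  apply/subsetP => _ /imsetP[x xA ->]; apply/imsetP; exists (x, f x) => //.
  rewrite inE /=; have /orP[/eqP fx|//] := fe x.
  by move: (fA x xA); rewrite fx => xA'; rewrite inE xA' in xA.
apply/trivIsetP => _ _ /imsetP[x xA ->] /imsetP[y yA ->].
apply: contraNT => /pred0Pn[z /= /andP[zx zy]].
by rewrite -(mE _ _ zx) (mE _ _ zy).
Qed.

(** * The characteristic polynomial and the nullity of a forest *)

(** An orbit with three or more points would be a cycle of the graph. *)
Lemma acyclic_edge_map_involutive {G : sgraph} (f : G -> G) :
  acyclic G -> injective f -> edge_map f -> involutive f.
Proof.
move=> acG fI fe x; apply/eqP; apply: contraT => ffx.
have fx : f x != x by apply: contraNneq ffx => fx; rewrite !fx.
have orbM y : y \in fingraph.orbit f x -> f y \in fingraph.orbit f x.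
  by rewrite -!fconnect_orbit => /connect_trans; apply; apply: fconnect1.
case: (acG (fingraph.orbit f x)).
  have Ux : uniq [:: x; f x; f (f x)].
    by rewrite /= !inE negb_or (inj_eq fI) (eq_sym x (f x)) (eq_sym x) fx ffx.
  apply: (uniq_leq_size Ux) => y; rewrite !inE.
  have xx := in_orbit f x.
  by case/or3P => /eqP->; rewrite ?xx ?orbM.
apply/andP; split; last exact: orbit_uniq.
(* A step of [f] is an edge only at unfixed points; by injectivity a fixed point in the orbit would
   make [x] fixed too. *)
apply: (@sub_in_cycle _ [pred y | f y != y] (frel f)) (cycle_orbit fI x).
  by move=> y z fy _ /eqP <-; have := fe y; rewrite (negPf fy).
apply/allP => y; rewrite -fconnect_orbit => /iter_findex <- /=.
apply: contraNneq fx; rewrite -iterS iterSr.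
by move=> e; apply/eqP; elim: (findex f x y) e => //= i IH /fI/IH.
Qed.

(** Orbits have one or two points, so size plus number of fixed points is 2 on each orbit. The
    number of orbits gives the sign of [s]. *)
Lemma card_porbits_involutive {T : finType} (s : {perm T}) : involutive s ->
  (2 * #|porbits s| = #|T| + #|[set x | s x == x]|)%N.
Proof.
move=> sK; have partS : partition (porbits s) setT.
  have := @orbit_partition _ _ _ 'P%act <[s]>%G setT.
  rewrite (_ : [set _ | x in _] = porbits s); first last.
    by apply/setP => B; apply/imsetP/imsetP => -[x _ ->]; exists x; rewrite ?porbitE.
  by apply; apply/actsP => t _ y; rewrite !inE.
have porbit2 x : porbit s x = [set x; s x].
  apply/setP => y; rewrite !inE; apply/porbitP/orP => [[i ->]|[]/eqP->].
  - rewrite permX; elim: i => [|i /= []/eqP->]; rewrite ?eqxx ?sK; by [left | right].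
  - by exists 0%N; rewrite permX.
  - by exists 1%N; rewrite permX.
have fixE : #|[set x | s x == x]| = (\sum_(B in porbits s) \sum_(x in B) (s x == x))%N.
  rewrite -big_trivIset ?(partition_trivIset partS) //= (cover_partition partS).
  rewrite -big_mkcondr /= -sum1_card; apply: eq_bigl => x.
  by rewrite !inE.
rewrite -cardsT (card_partition partS) fixE -big_split mulnC -sum_nat_const.
apply: eq_bigr => _ /imsetP[x _ ->]; rewrite porbit2.
have [fx|fx] := eqVneq (s x) x; first by rewrite fx setUid cards1 big_set1 fx eqxx.
have xs : (x == s x) = false by rewrite eq_sym (negPf fx).
by rewrite cards2 xs big_setU1 ?inE ?xs // big_set1 sK (negPf fx) xs.
Qed.

(** The permutations of the matrix indices whose Leibniz term in [char_poly (adjmx G)] does not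
    vanish. *)
Definition edge_perms (G : sgraph) : {set 'S_#|G|} :=
  [set s : 'S_#|G| | [forall i, (s i == i) || edge (enum_val i) (enum_val (s i))]].

Lemma edge_perms_map {G : sgraph} (s : 'S_#|G|) : s \in edge_perms G ->
  let f x := enum_val (s (enum_rank x)) in
  [/\ injective f, edge_map f & #|[set x | f x == x]| = #|[set i | s i == i]|].
Proof.
rewrite inE => /forallP se f; split.
- by move=> x y /enum_val_inj/perm_inj/enum_rank_inj.
- move=> x; have := se (enum_rank x); rewrite enum_rankK => /orP[/eqP sx|->].
    by rewrite /f sx enum_rankK eqxx.
  by rewrite orbT.
rewrite -(card_imset _ enum_rank_inj); congr #|pred_of_set _|.
apply/setP => i; apply/imsetP/idP => [[x]|].
  by rewrite !inE => /eqP fx ->; rewrite -{2}fx enum_valK.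
rewrite inE => /eqP si; exists (enum_val i); last by rewrite enum_valK.
by rewrite inE /f enum_valK si.
Qed.

Lemma edge_map_perm {G : sgraph} (f : G -> G) : injective f -> edge_map f ->
  exists2 s, s \in edge_perms G & #|[set i | s i == i]| = #|[set x | f x == x]|.
Proof.
move=> fI fe.
have gI : injective (fun i : 'I_#|G| => enum_rank (f (enum_val i))).
  by move=> i j /enum_rank_inj/fI/enum_val_inj.
have sP : perm gI \in edge_perms G.
  rewrite inE; apply/forallP => i; rewrite permE enum_rankK.
  by have /orP[/eqP->|->] := fe (enum_val i); rewrite ?enum_valK ?eqxx ?orbT.
exists (perm gI) => //; have [_ _ <-] := edge_perms_map _ sP.
by apply: eq_card => x; rewrite !inE permE !enum_rankK.
Qed.

(* Leibniz expansion: a permutation contributes only if it moves each vertex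
   along an edge, hence is an involution since there are no cycles; its sign is
   then determined by the number of its fixed points, so nothing cancels. *)
Lemma char_poly_adjmx_forest {G : sgraph} : acyclic G ->
  exists sg : nat -> nat, char_poly (adjmx G) =
    \sum_(s in edge_perms G)
       (-1) ^+ sg #|[set i | s i == i]| *: 'X^#|[set i | s i == i]|.
Proof.
move=> acG; pose n := #|G|.
(* With [k] fixed points there are [(n + k)./2] orbits, which gives the sign of the permutation; the
   [n - k] moved indices contribute a factor -1 each. *)
exists (fun k => (odd n (+) odd (n + k)./2) + (n - k))%N.
have entry i j :
    char_poly_mx (adjmx G) i j = 'X *+ (i == j) - (edge (enum_val i) (enum_val j))%:R.
  by rewrite /char_poly_mx !mxE rmorph_nat.
rewrite /char_poly /determinant (bigID [in edge_perms G]) /=.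
rewrite [X in _ + X]big1 ?addr0 => [|s]; last first.
  rewrite inE negb_forall => /existsP[i]; rewrite negb_or => /andP[si ei].
  by rewrite (bigD1 i) //= entry eq_sym (negPf si) (negPf ei) subr0 mul0r mulr0.
apply: eq_bigr => s sP.
have [fI fe fixf] := edge_perms_map _ sP.
have fK := acyclic_edge_map_involutive _ acG fI fe.
have sK : involutive s.
  move=> i; apply: enum_val_inj; have := fK (enum_val i).
  by rewrite !enum_valK.
have porb := card_porbits_involutive s sK.
set k := #|[set i | s i == i]| in porb *.
have -> : \prod_i char_poly_mx (adjmx G) i (s i) = (-1) ^+ (n - k) * 'X^k.
  rewrite (bigID (fun i => s i == i)) /= mulrC; congr (_ * _).
    rewrite (eq_bigr (fun _ => -1)) => [|i si].
      rewrite prodr_const; congr (_ ^+ _).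
      rewrite -[n]card_ord -(cardC [pred i | s i == i]) /k cardsE addKn.
      by apply: eq_card => i.
    move: sP; rewrite inE => /forallP/(_ i); rewrite (negPf si) /= => ei.
    by rewrite entry eq_sym (negPf si) ei sub0r.
  rewrite (eq_bigr (fun _ => 'X)) => [|i /eqP si].
    by rewrite prodr_const; congr (_ ^+ _); apply: eq_card => i; rewrite inE.
  by rewrite entry si eqxx edge_irr subr0.
rewrite mulrA -exprD; rewrite -signr_odd.
rewrite -mul_polyC rmorphXn rmorphN1; congr (_ * _).
rewrite -[RHS]signr_odd; congr (_ ^+ _); rewrite !oddD !oddb /odd_perm card_ord.
by congr (_ (+) odd _ (+) _); move: porb; rewrite card_ord -/n; lia.
Qed.
(** With [k] the number of fixed points of [f], the coefficient of ['X^k] is, up to sign, the number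
    of permutations in [edge_perms G] with [k] fixed points. This is nonzero because [f] provides
    one. *)
Lemma nullity_le {G : sgraph} (f : G -> G) : acyclic G ->
  injective f -> edge_map f -> (nullity G <= #|[set x | f x == x]|)%N.
Proof.
move=> acG fI fe; have [s sP <-] := edge_map_perm _ fI fe.
have p0 := monic_neq0 (char_poly_monic (adjmx G)).
rewrite /nullity mup_leq // subr0.
set k := #|_|; apply/negP => /Pdiv.Field.dvdpP[q pq].
have : (char_poly (adjmx G))`_k = 0 by rewrite pq coefMXn ltnSn.
have [sg ->] := char_poly_adjmx_forest acG.
rewrite coef_sum (bigID (fun t : 'S_#|G| => #|[set i | t i == i]| == k)) /=.
rewrite [X in _ + X]big1 ?addr0 => [|t /andP[_ tk]]; last first.
  by rewrite coefZ coefXn eq_sym (negPf tk) mulr0.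
rewrite (eq_bigr (fun _ => (-1) ^+ sg k)) => [|t /andP[_ /eqP ->]]; last first.
  by rewrite coefZ coefXn eqxx mulr1.
rewrite sumr_const -mulr_natr => /eqP.
rewrite mulf_eq0 signr_eq0 pnatr_eq0 /= -leqn0 leqNgt => /negP; apply.
by apply/card_gt0P; exists s; apply/andP; split.
Qed.

(** Every monomial of the expansion is divisible by ['X^k]. *)
Lemma nullity_ge {G : sgraph} (k : nat) : acyclic G ->
    (forall f : G -> G, injective f -> edge_map f -> (k <= #|[set x | f x == x]|)%N) ->
  (k <= nullity G)%N.
Proof.
move=> acG kfix.
have p0 := monic_neq0 (char_poly_monic (adjmx G)).
rewrite /nullity mup_geq // subr0.
have [sg ->] := char_poly_adjmx_forest acG.
apply: (big_ind (fun p => 'X^k %| p)) => [|p q|s sP]; [exact: dvdp0|exact: dvdp_add|].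
have [fI fe fixf] := edge_perms_map _ sP.
by rewrite -mul_polyC dvdp_mull // dvdp_exp2l // -fixf kfix.
Qed.

(** * The annihilation number bounds independent sets *)

Lemma annihilation_numberP (s : seq nat) :
  (annihilation_number s <= size s)%N /\
  (sumn (take (annihilation_number s) s) <= (sumn s)./2)%N.
Proof.
pose P a := (a <= size s)%N /\ (sumn (take a s) <= (sumn s)./2)%N.
apply: (big_ind P) => [|a b Pa Pb|a sa].
- by rewrite /P take0.
- by rewrite /maxn; case: ifP.
- by split=> //; rewrite -ltnS.
Qed.

Lemma annihilation_number_ge (s : seq nat) (k : nat) : (k <= size s)%N ->
  (sumn (take k s) <= (sumn s)./2)%N -> (k <= annihilation_number s)%N.
Proof.
rewrite -ltnS => ks sk.
exact: (@leq_bigmax_cond _ (fun a : 'I_(size s).+1 => (sumn (take a s) <= (sumn s)./2)%N)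
          (fun a => nat_of_ord a) (Ordinal ks)).
Qed.

Lemma sumn_take_le_subseq (s t : seq nat) : sorted leq s -> subseq t s ->
  (sumn (take (size t) s) <= sumn t)%N.
Proof.
elim: s t => [|x s IH] [|y t] //= ps.
have ss := path_sorted ps.
have [<-|_] := eqVneq y x; first by move=> ts; rewrite leq_add2l IH.
(* If [t] skips the head [x], the prefix of the tail with one more entry still bounds: [x] is at
   most that extra entry. *)
move=> yts; apply: leq_trans (IH _ ss yts).
have ts : (size t < size s)%N := size_subseq yts.
rewrite (take_nth 0%N ts) sumn_rcons addnC leq_add2l.
exact: (all_nthP 0%N (order_path_min leq_trans ps)).
Qed.

Lemma sumn_degree_seq (G : sgraph) : sumn (degree_seq G) = (\sum_(x : G) degree x)%N.
Proof.
by rewrite (perm_sumn (permEl (perm_sort leq _))) sumnE big_map big_enum.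
Qed.

Lemma size_degree_seq (G : sgraph) : size (degree_seq G) = #|G|.
Proof. by rewrite size_sort size_map cardE. Qed.

(** All edges at [A] lead outside [A], so the degree sum of [A] is at most that of its
    complement. *)
Lemma independent_degree_sum {G : sgraph} (A : {set G}) : is_independent A ->
  (2 * \sum_(x in A) degree x <= \sum_(x : G) degree x)%N.
Proof.
move=> indA; rewrite mul2n -addnn [leqRHS](bigID [in A]) /= leq_add2l.
have degE x : degree x = (\sum_(y : G) edge x y)%N.
  by rewrite -big_mkcondr /degree -sum1_card; apply: eq_bigl => y; rewrite inE.
rewrite (eq_bigr (fun x => \sum_(y | y \notin A) edge x y)%N) => [|x xA]; last first.
  rewrite degE (bigID [in A]) /= big1 // => y yA.
  by move/forall_inP/(_ x xA)/forall_inP/(_ y yA)/negPf: indA => ->.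
rewrite exchange_big /=; apply: leq_sum => y _; rewrite degE.
rewrite [leqRHS](bigID [in A]) /= (eq_bigr (fun x => edge y x : nat)) ?leq_addr //.
by move=> x _; rewrite edge_sym.
Qed.

(** The [#|A|] smallest degrees sum to no more than the degrees of [A], hence to at most half the
    total. *)
Lemma independent_le_annihilation {G : sgraph} (A : {set G}) : is_independent A ->
  (#|A| <= annihilation_number (degree_seq G))%N.
Proof.
move=> indA; apply: annihilation_number_ge; first by rewrite size_degree_seq max_card.
pose t := sort leq [seq degree x | x <- enum A].
have ts : subseq t (degree_seq G).
  apply: (subseq_sort leq_total leq_trans); apply: map_subseq.
  by rewrite (enumT G) {1}/enum_mem; apply: filter_subseq.
have szt : size t = #|A| by rewrite size_sort size_map cardE.
have sumt : sumn t = (\sum_(x in A) degree x)%N.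
  by rewrite (perm_sumn (permEl (perm_sort leq _))) sumnE big_map big_enum.
have := sumn_take_le_subseq _ _ (sort_sorted leq_total _) ts.
rewrite szt sumt; have := independent_degree_sum A indA; rewrite -sumn_degree_seq.
by move=> le1 /leq_trans; apply; lia.
Qed.

(** * Building an extremal tree leaf by leaf *)

(** Trees on a subset of a fixed type, so that adding a leaf leaves the vertex type unchanged. *)
Definition tree_on {T : finType} (S : {set T}) (e : rel T) : Prop :=
  [/\ symmetric e, irreflexive e, forall x y, e x y -> x \in S,
      {in S &, forall x y, connect e x y}
    & forall c : seq T, (2 < size c)%N -> ~ ucycle e c].

Definition add_edge {T : eqType} (e : rel T) (l w : T) : rel T :=
  fun x y => [|| e x y, (x == l) && (y == w) | (x == w) && (y == l)].

Lemma tree_on_add_leaf {T : finType} (S : {set T}) (e : rel T) (l w : T) :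
  tree_on S e -> l \notin S -> w \in S -> tree_on (l |: S) (add_edge e l w).
Proof.
move=> [eS eI eT eC eA] lS wS.
have lw : l != w by apply: contraNneq lS => ->.
have eSym : symmetric (add_edge e l w).
  move=> x y; rewrite /add_edge eS.
  by case: (x == l); case: (x == w); case: (y == l); case: (y == w).
have el y : e l y = false by apply/negP => /eT; rewrite (negPf lS).
have e'l y : add_edge e l w l y -> y = w.
  by rewrite /add_edge el eqxx (negPf lw) /= orbF => /eqP.
have lw1 : connect (add_edge e l w) l w by apply: connect1; rewrite /add_edge !eqxx orbT.
have lS1 : {in S, forall y, connect (add_edge e l w) l y}.
  move=> y yS; apply: connect_trans lw1 _.
  by apply: connect_sub (eC w y wS yS) => u v uv; apply: connect1; rewrite /add_edge uv.
split=> //.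
- move=> x; rewrite /add_edge eI /=.
  by have [->|] := eqVneq x l; rewrite ?(negPf lw) ?andbF.
- by move=> x y /or3P[/eT xS|/andP[/eqP-> _]|/andP[/eqP-> _]]; rewrite !inE ?eqxx ?xS ?wS ?orbT.
- have symC := sym_connect_sym eSym.
  have allC : {in l |: S, forall y, connect (add_edge e l w) l y}.
    by move=> y /setU1P[->//|]; apply: lS1.
  by move=> x y xS yS; apply: connect_trans (allC y yS); rewrite symC allC.
move=> c szc; have [lc|lc] := boolP (l \in c); last first.
  move=> /andP[cc Uc]; apply: (eA c szc); rewrite /ucycle Uc andbT.
  apply: (@sub_in_cycle _ [pred x | x != l]) cc.
    by move=> x y /= xl yl; rewrite /add_edge (negPf xl) (negPf yl) andbF !orbF.
  by apply/allP => x xc /=; apply: contraNneq lc => <-.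
(* In a cycle rotated to start at [l], the second and the last vertex both equal [w], which
   contradicts uniqueness. *)
have [i p rc] := rot_to lc; rewrite -(size_rot i) rc in szc.
rewrite -(rot_ucycle i) rc.
case: p szc {rc} => // y q; case/lastP: q => // q z _ /andP[/= /andP[/e'l ->]].
rewrite !rcons_path last_rcons (eSym z l) => /andP[_ /e'l ->].
by rewrite mem_rcons !inE eqxx /= andbF.
Qed.

Lemma degree_add_leaf {T : finType} (S : {set T}) (e : rel T) (l w x : T) :
    tree_on S e -> l \notin S -> w \in S ->
  #|[set y | add_edge e l w x y]| =
    (if x == l then 1 else #|[set y | e x y]| + (x == w))%N.
Proof.
move=> [eS eI eT eC eA] lS wS.
have lw : l != w by apply: contraNneq lS => ->.
have el y : e l y = false by apply/negP => /eT; rewrite (negPf lS).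
have [->|xl] := eqVneq x l.
  rewrite (_ : [set _ | _] = [set w]) ?cards1 //.
  by apply/setP => y; rewrite !inE /add_edge el eqxx (negPf lw) /= orbF.
rewrite /add_edge (negPf xl) /=; have [->|xw] /= := eqVneq x w; last first.
  by rewrite addn0; apply: eq_card => y; rewrite !inE orbF.
rewrite (_ : [set _ | _] = l |: [set y | e w y]); last first.
  by apply/setP => y; rewrite !inE orbC.
by rewrite cardsU1 inE eS el addnC.
Qed.

Lemma sum_card_le {T : finType} (B : {set T}) (d : T -> nat) :
  {in B, forall x, (d x <= 1)%N} -> (\sum_(x in B) d x <= #|B|)%N.
Proof. by move=> dB; rewrite -sum1_card; apply: leq_sum. Qed.

(* Which leaf to prune: the pair keeps [A] independent, and the edge removed is
   incident to [A] unless the bound on [A] has slack. *)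
Lemma leaf_choice {T : finType} (m : nat) (S A : {set T}) (d : T -> nat) :
    A \subset S -> #|S| = m.+2 -> {in S, forall x, (0 < d x)%N} ->
    (\sum_(x in S) d x = 2 * m.+1)%N -> (\sum_(x in A) d x <= m.+1)%N ->
  exists l w, [/\ l \in S, w \in S :\ l, d l = 1%N, (0 < m)%N -> (1 < d w)%N
    & ~~ ((l \in A) && (w \in A)) /\ (\sum_(x in A) d x <= m + ((l \in A) || (w \in A)))%N].
Proof.
move=> AS cardS d0 sumS sumA.
have SD (B : {set T}) : B \subset S ->
    (\sum_(x in S) d x = \sum_(x in B) d x + \sum_(x in S :\: B) d x)%N /\
    #|S| = (#|B| + #|S :\: B|)%N.
  move=> BS; have SB : S :&: B = B by apply/setIidPr.
  by rewrite (big_setID B) -(cardsID B S) SB.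
(* Otherwise [0 < m] and all degrees off [B] are at most 1. The sums then force [B] to be the single
   leaf [l], and the total is at most [m + 2], less than [2 * m.+1]. *)
have branch (B : {set T}) l : B \subset S -> l \in B -> d l = 1%N ->
    (\sum_(x in B) d x <= m.+1)%N ->
    exists2 w, w \in S :\: B & (0 < m)%N -> (1 < d w)%N.
  move=> BS lB dl sumB; have [sumSB cardSB] := SD B BS.
  suff /exists_inP[w wB /implyP dw] : [exists w in S :\: B, (0 < m)%N ==> (1 < d w)%N].
    by exists w.
  apply: contraT => /exists_inPn nobr.
  have low : {in S :\: B, forall w, (d w <= 1)%N}.
    by move=> w /nobr; rewrite negb_imply -leqNgt => /andP[].
  have := sum_card_le _ _ low => sumD.
  have B1 : #|B| = 1%N.
    have : (0 < #|B|)%N by apply/card_gt0P; exists l.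
    by lia.
  have sumB1 : (\sum_(x in B) d x = 1)%N.
    have /cards1P[l' Bl] : #|B| == 1%N by rewrite B1.
    by move: lB; rewrite Bl inE => /eqP <-; rewrite big_set1.
  have /card_gt0P[w /nobr] : (0 < #|S :\: B|)%N by lia.
  by rewrite negb_imply; lia.
have [/exists_inP[l lA /eqP dl]|/exists_inPn noleafA] := boolP [exists x in A, d x == 1%N].
  have [w wA dw] := branch A l AS lA dl sumA.
  have lS := subsetP AS l lA.
  move: wA; rewrite inE => /andP[wA wS].
  exists l, w; rewrite lA (negPf wA) addn1; split=> //.
  by rewrite !inE wS andbT; apply: contraNneq wA => ->.
(* No leaf lies in [A], but [S] has one, since the average degree is below 2. *)
have [l lS dl] : exists2 l, l \in S & d l = 1%N.
  have [/exists_inP[l lS /eqP dl]|/exists_inPn noleaf] := boolP [exists x in S, d x == 1%N].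
    by exists l.
  have : (\sum_(x in S) 2 <= \sum_(x in S) d x)%N.
    by apply: leq_sum => x xS; have := d0 x xS; have := noleaf x xS; lia.
  by rewrite sum_nat_const; lia.
have lA : l \notin A by apply/negP => /noleafA; rewrite dl.
(* The leaf is attached to any vertex of [A], which has degree at least 2; if [A] is empty, its sum
   bound is trivial. *)
have [A0|[w wA]] := set_0Vmem A.
  have [||||w wl dw] := branch [set l] l; rewrite ?sub1set ?set11 ?big_set1 ?dl //.
  exists l, w; split=> //; rewrite A0 !inE /=; split=> //.
  by rewrite big_set0.
have dw : (1 < d w)%N.
  by have := noleafA w wA; have := d0 w (subsetP AS w wA); lia.
exists l, w; rewrite wA (negPf lA) addn1; split=> //.
by rewrite !inE (subsetP AS w wA) andbT; apply: contraNneq lA => <-.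
Qed.

(** Induction on the number [m] of edges: [leaf_choice] gives [l] and [w], [l] is deleted and the
    degree of [w] lowered by one, and [l] is later attached to [w] again. The guard [0 < m] admits
    the one-vertex tree, of degree 0. *)
Lemma realize_tree {T : finType} (m : nat) (S A : {set T}) (d : T -> nat) :
    A \subset S -> #|S| = m.+1 -> ((0 < m)%N -> {in S, forall x, (0 < d x)%N}) ->
    (\sum_(x in S) d x = 2 * m)%N -> (\sum_(x in A) d x <= m)%N ->
  exists e : rel T, [/\ tree_on S e, {in S, forall x, #|[set y | e x y]| = d x}
    & {in A &, forall x y, ~~ e x y}].
Proof.
elim: m => [|m IH] in S A d *; move=> AS cardS d0 sumS sumA.
  have /cards1P[v Sv] : #|S| == 1%N by rewrite cardS.
  exists (fun _ _ => false); split=> //; last first.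
    move=> x; rewrite Sv inE => /eqP ->; move: sumS; rewrite Sv big_set1 muln0 => ->.
    by apply: eq_card0 => y; rewrite inE.
  split=> // [x y|[|a [|b c]] //].
    by rewrite Sv !inE => /eqP-> /eqP->; apply: connect0.
have {}d0 := d0 isT.
have [l [w [lS wSl dl dw [lwA sumA']]]] := leaf_choice _ _ _ _ AS cardS d0 sumS sumA.
have wS : w \in S by apply: (subsetP (subsetDl _ _)) wSl.
pose d' x := (d x - (x == w))%N.
have dE (B : {set T}) : (\sum_(x in B) d x = \sum_(x in B) d' x + (w \in B))%N.
  have -> : (w \in B : nat) = (\sum_(x in B) (x == w))%N.
    case: (boolP (w \in B)) => wB; last first.
      by rewrite big1 // => x xB; case: eqP => // xw; rewrite -xw xB in wB.
    by rewrite (big_setD1 w) //= eqxx big1 // => x; rewrite !inE => /andP[/negPf->].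
  rewrite -big_split /=; apply: eq_bigr => x _; rewrite /d' subnK //.
  by case: eqP => [->|//]; apply: d0.
have cardSl : #|S :\ l| = m.+1 by move: cardS; rewrite (cardsD1 l) lS; lia.
have sumSl : (\sum_(x in S :\ l) d' x = 2 * m)%N.
  by move: sumS; rewrite (big_setD1 l) //= dl dE wSl; lia.
(* The bound falls by one: either [A] loses [l], or [w] in [A] loses one degree, or there was
   slack. *)
have sumAl : (\sum_(x in A :\ l) d' x <= m)%N.
  have wl : w != l by move: wSl; rewrite !inE => /andP[].
  have [lA|lA] := boolP (l \in A).
    by move: sumA; rewrite (big_setD1 l) //= dl dE; lia.
  have -> : A :\ l = A by apply/setDidPl; rewrite disjoint_sym disjoints1.
  by move: sumA'; rewrite dE (negPf lA) /=; lia.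
have [m0 x|e [treeE degE indE]] := IH (S :\ l) (A :\ l) d' (setSD _ AS) cardSl _ sumSl sumAl.
  rewrite !inE => /andP[xl xS]; rewrite /d'; have := d0 x xS.
  by case: eqP => [->|_]; have := dw m0; lia.
have lSl : l \notin S :\ l by rewrite !inE eqxx.
exists (add_edge e l w); rewrite -(setD1K lS); split.
- exact: tree_on_add_leaf.
- move=> x xS; rewrite (degree_add_leaf _ _ _ _ _ treeE lSl wSl).
  move: xS; rewrite in_setU1; have [->|xl] //= := eqVneq x l.
  move=> xS; rewrite degE // /d' subnK //.
  by case: eqP => [->|//]; apply: d0.
have [_ _ eT _ _] := treeE.
have eA x y : x \in A -> y \in A -> ~~ e x y.
  move=> xA yA; apply/negP => xy.
  have xAl : x \in A :\ l by rewrite !inE xA andbT; have := eT _ _ xy; rewrite !inE => /andP[].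
  have yAl : y \in A :\ l.
    rewrite !inE yA andbT; have [eS _ _ _ _] := treeE.
    by have := eT y x; rewrite eS xy !inE => /(_ isT)/andP[].
  by move/negP: (indE x y xAl yAl).
move=> x y xA yA; apply: contra lwA => /or3P[xy|/andP[/eqP<- /eqP<-]|/andP[/eqP<- /eqP<-]].
- by move: (eA x y xA yA); rewrite xy.
- by rewrite xA yA.
- by rewrite xA yA.
Qed.
(** The vertices are the positions in [s], and [A] consists of the first [annihilation_number s] of
    them, whose degrees sum to at most [n - 1]. *)
Lemma extremal_tree {n : nat} {s : seq nat} : tree_degree_seq n s ->
  exists2 G, trees_with s G &
    exists2 A : {set G}, is_independent A & #|A| = annihilation_number s.
Proof.
move=> [szs ss _ sums s0].
case: n => [|m] in szs sums s0 *; first by lia.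
have [aS sumA] := annihilation_numberP s; set a := annihilation_number s in aS sumA *.
pose A := [set i : 'I_m.+1 | (i < a)%N].
have narrow (F : nat -> nat) : (\sum_(i in A) F i = \sum_(i < a) F i)%N.
  rewrite (big_ord_widen m.+1 F) -?szs //.
  by apply: eq_bigl => i; rewrite inE.
have cardA : #|A| = a by rewrite -sum1_card (narrow (fun _ => 1%N)) sum1_card card_ord.
have d0 : (0 < m)%N -> {in [set: 'I_m.+1], forall i : 'I_m.+1, (0 < nth 0%N s i)%N}.
  move=> m0 i _; rewrite lt0n; apply: contraNneq (s0 m0) => <-.
  by rewrite mem_nth ?szs.
have sumT : (\sum_(i in [set: 'I_m.+1]) nth 0%N s i = 2 * m)%N.
  have -> : (\sum_(i in [set: 'I_m.+1]) nth 0%N s i = sumn s)%N.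
    rewrite sumnE (big_nth 0%N) szs big_mkord.
    by apply: eq_bigl => i; rewrite inE.
  by lia.
have sumAm : (\sum_(i in A) nth 0%N s i <= m)%N.
  rewrite narrow; have -> : (\sum_(i < a) nth 0%N s i = sumn (take a s))%N.
    rewrite sumnE (big_nth 0%N) big_mkord size_takel //.
    by apply: eq_bigr => i _; rewrite nth_take.
  by apply: leq_trans sumA _; lia.
have cardT' : #|[set: 'I_m.+1]| = m.+1 by rewrite cardsT card_ord.
have [e [[eS eI _ eC eA] degE indA]] := realize_tree m _ A _ (subsetT A) cardT' d0 sumT sumAm.
pose G := SGraph eS eI; exists G; last first.
  exists (A : {set G}) => //.
  by apply/forall_inP => x xA; apply/forall_inP => y; apply: indA.
split.
  split; last exact: eA.
  split; first by rewrite card_ord.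
  by move=> x y; apply: eC; rewrite inE.
have degs : [seq degree x | x <- enum G] = s.
  rewrite (eq_map (g := nth 0%N s \o val)); last first.
    by move=> i; apply: degE; rewrite inE.
  by rewrite map_comp val_enum_ord -szs map_nth_iota0 // take_size.
by rewrite /degree_seq degs; apply: (sorted_sort leq_trans).
Qed.

(** * Bounds for all trees, attained by the extremal one *)

Theorem theorem6 (n : nat) (s : seq nat) (hs : tree_degree_seq n s) :
  [/\ is_min (trees_with s) matching_number
        (n%:Z - (annihilation_number s)%:Z),
      is_max (trees_with s) nullity
        (2 * (annihilation_number s)%:Z - n%:Z)
    & is_max (trees_with s) independence_number
        (annihilation_number s)%:Z].
Proof.
have cardG G : trees_with s G -> #|G| = n.
  by move=> [_ dG]; have [<- _ _ _ _] := hs; rewrite -dG size_degree_seq.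
have indG (G : sgraph) (A : {set G}) : trees_with s G -> is_independent A ->
    (#|A| <= annihilation_number s)%N.
  by move=> [_ <-]; apply: independent_le_annihilation.
have matG G : trees_with s G -> (n <= matching_number G + annihilation_number s)%N.
  move=> tG; have [[_ acG] _] := tG; have [f [A [fK fe indA fA]]] := konig acG.
  have := matching_number_ge f A fK fe fA; have := indG G A tG indA.
  by have := cardsC A; rewrite (cardG G tG); lia.
have nulG G : trees_with s G -> (nullity G + n <= 2 * annihilation_number s)%N.
  move=> tG; have [[_ acG] _] := tG; have [f [A [fK fe indA fA]]] := konig acG.
  have := nullity_le f acG (inv_inj fK) fe; have := indG G A tG indA.
  by have := fixpoints_konig f A fK fe indA fA; rewrite (cardG G tG); lia.
have alpG G : trees_with s G -> (independence_number G <= annihilation_number s)%N.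
  by move=> tG; apply/bigmax_leqP => A indA; apply: indG.
have [G tG [A indA cardA]] := extremal_tree hs.
have [[_ acG] _] := tG; have cG := cardG G tG.
split; split.
- exists G => //; have : (matching_number G + #|A| <= n)%N.
    have : (matching_number G <= n - #|A|)%N.
      apply/bigmax_leqP => M MM; have := matching_le M A MM indA.
      by rewrite cG; lia.
    by have := max_card A; rewrite cG; lia.
  by have := matG G tG; rewrite cardA; lia.
- by move=> H /matG; lia.
(* The truncated subtraction is exact, since [nulG] implies [n <= 2 * annihilation_number s]. *)
- exists G => //; have : (2 * annihilation_number s - n <= nullity G)%N.
    apply: nullity_ge => // f fI fe.
    by have := fixpoints_ge f A fI fe indA; rewrite cG cardA; lia.
  by have := nulG G tG; lia.
- by move=> H /nulG; lia.
- exists G => //; have : (#|A| <= independence_number G)%N.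
    exact: (@leq_bigmax_cond _ _ (fun B : {set G} => #|B|)).
  by have := alpG G tG; rewrite cardA; lia.
- by move=> H /alpG; lia.
Qed.
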